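(* Let $X$ be a continuum and $n\in\mathbb N$. Let $A\in 2^X$ and let $C\in 2^X$ be such that $\mathrm{int}(A)\subset C\subset A$, where $\mathrm{int}(A)$ is the interior of $A$ in $X$. Then: (1) if $A\in NBO_n(X)$, then $C\in NBO_n(X)$; (2) if $A\in NB_n^*(X)$, then $C\in NB_n^*(X)$; (3) if $A\in S_n(X)$, then $C\in S_n(X)$; (4) if $A\in NSC_n(X)$, then $C\in NSC_n(X)$; (5) if $A\in NC_n(X)$, then $C\in NC_n(X)$.
   Context: All spaces are metric; a continuum is a compact connected space with more than one point; $\mathbb N=\{1,2,\dots\}$. For a non-empty space $Y$ and $n\in\mathbb N$: $2^Y$ is the set of non-empty compact subsets of $Y$; $F_n(Y)$ is the set of elements of $2^Y$ with at most $n$ points; $C_n(Y)$ is the set of elements of $2^Y$ with at most $n$ components. A non-empty space $Y$ is (interiors taken in $Y$): - $n$-$Qo$ if there exists $B\in F_n(Y)$ such that for every non-empty open set $U$ of $Y$ there exists a continuum $D\subset Y$ with $B\cap \mathrm{int}(D)\neq\emptyset\neq \mathrm{int}(D)\cap U$; - $n$-$Q4$ if there exists $B\in F_n(Y)$ such that for every non-empty open set $U$ of $Y$ there exists a continuum $D\subset Y$ with $B\cap D\neq\emptyset\neq D\cap U$; - $n$-$Q5$ if for each finite family $\mathcal U$ of non-empty open subsets of $Y$ there exists $D\in C_n(Y)$ with $D\cap U\neq\emptyset$ for every $U\in\mathcal U$; - $n$-$Q6$ if for each collection of $n+1$ non-empty open sets $U_1,\dots,U_{n+1}$ of $Y$ there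 exists $D\in C_n(Y)$ with $D\cap U_i\neq\emptyset$ for every $i\in\{1,\dots,n+1\}$. For a non-degenerate compact metric space $X$ define the following subsets of $2^X$: $NBO_n(X)=\{A\in 2^X: A=X$ or $X-A$ is $n$-$Qo\}$; $NB_n^*(X)=\{A\in 2^X: A=X$ or $X-A$ is $n$-$Q4\}$; $S_n(X)=\{A\in 2^X: A=X$ or $X-A$ is $n$-$Q5\}$; $NSC_n(X)=\{A\in 2^X: A=X$ or $X-A$ is $n$-$Q6\}$; $NC_n(X)=\{A\in 2^X: X-A$ has at most $n$ components$\}$. *)

(* Defs.v *)
From mathcomp Require Import all_boot all_order all_algebra.
From mathcomp Require Import all_classical all_reals topology.

Set Implicit Arguments.
Unset Strict Implicit.
Unset Printing Implicit Defensive.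

Local Open Scope classical_set_scope.
Local Open Scope card_scope.

(* The topological notions below do not mention a metric. A subset [B] of a
   space, seen as a space, is the type [set_type B] with its subtype topology. *)
Section SpaceProperties.
Context {Y : topologicalType}.
Implicit Types (n : nat) (A B D : set Y).

Definition continuum D :=
  [/\ compact D, connected D & exists x y, [/\ D x, D y & x <> y]].

(* $2^Y$ *)
Definition hyperspace : set (set Y) := [set A | A !=set0 /\ compact A].

(* [connected_component A x] is only a component of [A] for [x] in [A], hence
   the range of the comprehension. *)
Definition components A : set (set Y) := [set connected_component A x | x in A].

Definition Fn n : set (set Y) := [set A | hyperspace A /\ A #<= `I_n].

Definition Cn n : set (set Y) :=
  [set A | hyperspace A /\ components A #<= `I_n].

End SpaceProperties.

(* In the next four definitions [Y] is meant to be non-empty; they are only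
   applied to complements of proper subsets. *)
Definition Qo (n : nat) (Y : topologicalType) :=
  exists2 B : set Y, Fn n B & forall U : set Y, open U -> U !=set0 ->
    exists D : set Y, [/\ continuum D, B `&` interior D !=set0
                        & interior D `&` U !=set0].

Definition Q4 (n : nat) (Y : topologicalType) :=
  exists2 B : set Y, Fn n B & forall U : set Y, open U -> U !=set0 ->
    exists D : set Y, [/\ continuum D, B `&` D !=set0 & D `&` U !=set0].

Definition Q5 (n : nat) (Y : topologicalType) :=
  forall F : set (set Y), finite_set F ->
    (forall U, F U -> open U /\ U !=set0) ->
    exists2 D : set Y, Cn n D & forall U, F U -> D `&` U !=set0.

(* The $n+1$ open sets form an indexed family: repetitions are allowed. *)
Definition Q6 (n : nat) (Y : topologicalType) :=
  forall U : 'I_n.+1 -> set Y, (forall i, open (U i) /\ U i !=set0) ->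
    exists2 D : set Y, Cn n D & forall i, D `&` U i !=set0.

Section Hyperspaces.
Variable X : topologicalType.

Definition NBO n : set (set X) :=
  [set A | hyperspace A /\ (A = [set: X] \/ Qo n (set_type (~` A)))].

Definition NBstar n : set (set X) :=
  [set A | hyperspace A /\ (A = [set: X] \/ Q4 n (set_type (~` A)))].

Definition Sn n : set (set X) :=
  [set A | hyperspace A /\ (A = [set: X] \/ Q5 n (set_type (~` A)))].

Definition NSC n : set (set X) :=
  [set A | hyperspace A /\ (A = [set: X] \/ Q6 n (set_type (~` A)))].

Definition NC n : set (set X) :=
  [set A | hyperspace A /\ components (~` A) #<= `I_n].

End Hyperspaces.

(* Main.v *)
Require Import Defs.
From mathcomp Require Import all_boot all_order all_algebra.
From mathcomp Require Import all_classical all_reals topology.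

(** Put [W = X - A] and [V = X - C]. The hypothesis on [C] says exactly that
    [W] is contained in [V] and [V] in [X - int A], which is the closure of
    [W]. So [W] is an open dense subspace of [V].

    For (1)-(4) the inclusion of [W] into [V] is a continuous, injective, open
    map with dense range. Such a map transports each of the four properties:
    density turns a non-empty open set of [V] into a non-empty open set of [W],
    the property of [W] provides a witness there, and the image of that witness
    works in [V]. A continuous image of a set has no more components than the
    set itself ([card_components_le]), so images of members of [Cn n] are again
    in [Cn n]; injectivity keeps images of continua non-degenerate; and
    openness, which is where compactness of [A] enters, keeps interior points
    interior.

    For (5), when [W] has finitely many components their closures cover [V].
    Adding to a connected set a point of its closure leaves it connected, so
    every component of [V] contains a component of [W] and
    [card_components_le] applies again. *)

Local Open Scope classical_set_scope.
Local Open Scope card_scope.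

(** * Counting components *)

(** A component [K] of [W] is sent to the component of [V] containing
    [f @` K]. The last hypothesis says that this reaches every component. *)
Lemma card_components_le {Y Z : topologicalType} (f : Y -> Z)
    (W : set Y) (V : set Z) :
  continuous f -> f @` W `<=` V ->
  (forall z, V z -> exists2 y, W y & connected_component V z (f y)) ->
  components V #<= components W.
Proof.
move=> cf fWV surj.
(* A union over all of [K] avoids choosing a point: all its terms agree. *)
pose h (K : set Y) := \bigcup_(y in K) connected_component V (f y).
apply: card_le_trans (card_image_le h _).
apply: subset_card_le => _ [z Vz <-].
have [y Wy zfy] := surj z Vz.
exists (connected_component W y); first by exists y.
apply/seteqP; split=> x.
- move=> [y' yy' y'x].
  apply: connected_component_trans y'x; apply: connected_component_trans zfy _.
  exists (f @` connected_component W y); last by exists y'.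
  split.
  + by exists y => //; exact: connected_component_refl.
  + apply: subset_trans fWV; apply: image_subset.
    exact: connected_component_sub.
  + apply: connected_continuous_connected; first exact: component_connected.
    exact: continuous_subspaceT.
- move=> zx; exists y; first exact: connected_component_refl.
  exact: connected_component_trans (connected_component_sym zfy) zx.
Qed.

Lemma card_components_image {Y Z : topologicalType} (f : Y -> Z) (D : set Y) :
  continuous f -> components (f @` D) #<= components D.
Proof.
move=> cf; apply: card_components_le cf _ _ => // _ [y Dy <-].
by exists y => //; apply: connected_component_refl; exists y.
Qed.

(** Finiteness is essential: only a finite union of closures is closed, hence
    contains [closure W]. *)
Lemma closure_sub_closure_components {X : topologicalType} {W : set X} :
  finite_set (components W) ->
  closure W `<=` \bigcup_(K in components W) closure K.
Proof.
move=> finW; rewrite closureE; apply: smallest_sub.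
  by apply: closed_bigcup => // K _; exact: closed_closure.
move=> x Wx; exists (connected_component W x); first by exists x.
exact/subset_closure/connected_component_refl.
Qed.

(** Only one point is added, and a point of [closure K] cannot be split off
    from [K]: each relatively clopen set containing [K] contains [x] by
    closedness, and each one containing [x] meets [K] by openness. *)
Lemma connected_setU1_closure {X : topologicalType} {K : set X} {x : X} :
  connected K -> closure K x -> connected (x |` K).
Proof.
move=> cK Kx U U0 [O oO UO] [F cF UF].
suff KU : K `<=` U.
  rewrite eqEsubset; split; first by rewrite UF => ? [].
  move=> y [->|/KU //]; rewrite UF; split; first by left.
  apply: cF; apply: closureS Kx => z /KU; rewrite UF => -[] //.
rewrite -setIidPl; apply: cK.
- have [k [Kk Ok]] : K `&` O !=set0.
    case: U0 => u; rewrite UO => -[[->|Ku] Ou]; last by exists u.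
    by apply: Kx; exact: open_nbhs_nbhs.
  by exists k; split=> //; rewrite UO; split=> //; right.
- by exists O; rewrite // UO setIA (setIidl (@subsetUr _ _ _)).
- by exists F; rewrite // UF setIA (setIidl (@subsetUr _ _ _)).
Qed.

Lemma card_components_between {X : topologicalType} {W V : set X} :
  W `<=` V -> V `<=` closure W -> finite_set (components W) ->
  components V #<= components W.
Proof.
move=> WV VW finW; apply: (card_components_le id) => [x||x Vx].
- exact: cvg_id.
- by move=> _ [x Wx <-]; exact: WV.
- have [_ [y Wy <-] Kx] := closure_sub_closure_components finW _ (VW _ Vx).
  exists y => //; exists (x |` connected_component W y).
    split.
    + by left.
    + by move=> z [->//|/connected_component_sub /WV].
    + by apply: connected_setU1_closure Kx; exact: component_connected.
  by right; exact: connected_component_refl.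
Qed.

(** * Transport along maps with dense range *)

Section DenseRange.
Context {Y Z : topologicalType} (f : Y -> Z).
Hypotheses (cf : continuous f) (df : dense (range f)).

Lemma hyperspace_image {D : set Y} : hyperspace D -> hyperspace (f @` D).
Proof.
move=> [[y Dy] cD]; split; first by exists (f y), y.
by apply: continuous_compact => //; exact: continuous_subspaceT.
Qed.

Lemma Fn_image {n} {B : set Y} : Fn n B -> Fn n (f @` B).
Proof.
move=> [hB Bn]; split; first exact: hyperspace_image.
exact: card_le_trans (card_image_le f B) Bn.
Qed.

Lemma Cn_image {n} {D : set Y} : Cn n D -> Cn n (f @` D).
Proof.
move=> [hD Dn]; split; first exact: hyperspace_image.
exact: card_le_trans (card_components_image f D cf) Dn.
Qed.

Lemma continuum_image {D : set Y} :
  injective f -> continuum D -> continuum (f @` D).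
Proof.
move=> inj_f [kD cD [x [y [Dx Dy xy]]]]; split.
- by apply: continuous_compact => //; exact: continuous_subspaceT.
- apply: connected_continuous_connected => //; exact: continuous_subspaceT.
- by exists (f x), (f y); split; [exists x|exists y|move/inj_f].
Qed.

Lemma interior_image (D : set Y) :
  (forall U, open U -> open (f @` U)) -> f @` interior D `<=` interior (f @` D).
Proof.
move=> of_; rewrite -open_subsetE; last exact/of_/open_interior.
apply: image_subset; exact: interior_subset.
Qed.

Lemma preimage_open_neq0 {U : set Z} :
  open U -> U !=set0 -> open (f @^-1` U) /\ f @^-1` U !=set0.
Proof.
move=> oU U0; split; first by move/continuousP: cf => /(_ U oU).
by have [z [Uz [y _ yz]]] := df _ U0 oU; exists y; rewrite /preimage /= yz.
Qed.

Lemma image_meets {D : set Y} {U : set Z} :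
  D `&` f @^-1` U !=set0 -> f @` D `&` U !=set0.
Proof. by move=> [y [Dy Uy]]; exists (f y); split=> //; exists y. Qed.

Lemma Qo_image n :
  injective f -> (forall U, open U -> open (f @` U)) -> Qo n Y -> Qo n Z.
Proof.
move=> inj_f of_ [B FB H]; exists (f @` B); first exact: Fn_image.
move=> U oU U0; have [oV V0] := preimage_open_neq0 oU U0.
have [D [cD [b [Bb Db]] DU]] := H _ oV V0.
exists (f @` D); split; first exact: continuum_image.
- exists (f b); split; first by exists b.
  by apply: interior_image => //; exists b.
- have [z [Dz Uz]] := image_meets DU.
  by exists z; split=> //; exact: interior_image.
Qed.

Lemma Q4_image n : injective f -> Q4 n Y -> Q4 n Z.
Proof.
move=> inj_f [B FB H]; exists (f @` B); first exact: Fn_image.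
move=> U oU U0; have [oV V0] := preimage_open_neq0 oU U0.
have [D [cD [b [Bb Db]] DU]] := H _ oV V0.
exists (f @` D); split; [exact: continuum_image| |exact: image_meets].
by exists (f b); split; exists b.
Qed.

Lemma Q5_image n : Q5 n Y -> Q5 n Z.
Proof.
move=> H F finF FO.
have [||D CD DF] := H (preimage f @` F).
- exact: finite_image.
- by move=> _ [U /FO[oU U0] <-]; exact: preimage_open_neq0.
exists (f @` D); first exact: Cn_image.
by move=> U FU; apply/image_meets/DF; exists U.
Qed.

Lemma Q6_image n : Q6 n Y -> Q6 n Z.
Proof.
move=> H U UO.
have [|D CD DU] := H (fun i => f @^-1` U i).
  by move=> i; have [oU U0] := UO i; exact: preimage_open_neq0.
exists (f @` D); first exact: Cn_image.
by move=> i; exact/image_meets/DU.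
Qed.

End DenseRange.

(** * Inclusions of subspaces *)

Section Inclusion.
Context {X : topologicalType} {W V : set X} (WV : W `<=` V).

Definition inclusion (x : set_type W) : set_type V :=
  exist _ (set_val x) (mem_set (WV (set_val x) (set_valP x))).

Lemma inclusion_inj : injective inclusion.
Proof. by move=> x y /(congr1 set_val) /= xy; apply: val_inj. Qed.

Lemma inclusion_continuous : continuous inclusion.
Proof.
apply: continuous_comp_initial.
exact: (@initial_continuous (set_type W) X set_val).
Qed.

Lemma inclusion_open : open W ->
  forall U : set (set_type W), open U -> open (inclusion @` U).
Proof.
move=> oW U [O oO OU]; exists (O `&` W); first exact: openI.
apply/seteqP; split=> [v [Ov Wv]|_ [w + <-]].
  by exists (exist _ (set_val v) (mem_set Wv)); [rewrite -OU|apply: val_inj].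
by rewrite -OU => Ow; split=> //; exact: (set_valP w).
Qed.

Lemma inclusion_dense : V `<=` closure W -> dense (range inclusion).
Proof.
move=> VW U [v Uv] [O oO OU].
have Ov : O (set_val v) by move: Uv; rewrite -OU.
have [w [Ww Ow]] : W `&` O !=set0.
  by apply: (VW _ (set_valP v)); exact: open_nbhs_nbhs.
pose w' : set_type W := exist _ w (mem_set Ww).
by exists (inclusion w'); split; [rewrite -OU|exists w'].
Qed.

End Inclusion.

Theorem theorem3p16 (R : realType) (X : metricType R) (n : nat)
    (hX : continuum [set: X]) (hn : (0 < n)%N)
    (A C : set X) (hA : hyperspace A) (hC : hyperspace C)
    (hAC : interior A `<=` C) (hCA : C `<=` A) :
  (NBO n A -> NBO n C) /\
  (NBstar n A -> NBstar n C) /\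
  (Sn n A -> Sn n C) /\
  (NSC n A -> NSC n C) /\
  (NC n A -> NC n C).
Proof.
have oA : open (~` A).
  rewrite openC; apply: compact_closed hA.2; exact: metric_hausdorff.
have WV : ~` A `<=` ~` C by rewrite setCS.
have VW : ~` C `<=` closure (~` A) by rewrite closure_setC setCS.
have CT : A = [set: X] -> C = [set: X].
  by move=> AT; apply/seteqP; split=> // x _; apply: hAC; rewrite AT interiorT.
have cf := inclusion_continuous WV.
have df := inclusion_dense WV VW.
split=> [|]; last split; last split; last split.
- move=> [_ [/CT|QA]]; split=> //; [by left|right].
  apply: Qo_image cf df _ _ _ QA; first exact: inclusion_inj.
  exact: inclusion_open.
- move=> [_ [/CT|QA]]; split=> //; [by left|right].
  by apply: Q4_image cf df _ _ QA; exact: inclusion_inj.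
- move=> [_ [/CT|QA]]; split=> //; [by left|right].
  exact: Q5_image cf df _ QA.
- move=> [_ [/CT|QA]]; split=> //; [by left|right].
  exact: Q6_image cf df _ QA.
- move=> [_ An]; split=> //; apply: (card_le_trans _ An).
  by apply: (card_components_between WV VW); apply/finite_set_leP; exists n.
Qed.
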